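(* The $\Sigma$-theory of $\mathcal{T}(\mathcal{L}_{\mathsf{T}^-})=(\mathbf{H},\sqsubseteq)$, i.e. the set of all $\Sigma$-sentences in the language $\{\sqsubseteq\}$ that are true in $(\mathbf{H},\sqsubseteq)$, is undecidable.
   Context: Let $\mathbf{H}$ be the set of all variable-free terms built from a constant $\perp$ and a binary function symbol $\langle\cdot,\cdot\rangle$ (finite full binary trees), and let $\sqsubseteq$ be the subterm relation: $s\sqsubseteq t$ iff $s=t$ or $t=\langle t_1,t_2\rangle$ and $s\sqsubseteq t_1$ or $s\sqsubseteq t_2$. The language $\mathcal{L}_{\mathsf{T}^-}=\{\sqsubseteq\}$ has only this binary relation symbol (plus equality). Bounded quantifiers $\exists x\sqsubseteq t\,\phi$, $\forall x\sqsubseteq t\,\phi$ abbreviate $\exists x[x\sqsubseteq t\wedge\phi]$ and $\forall x[x\sqsubseteq t\rightarrow\phi]$. $\Sigma$-formulas are defined inductively: atomic formulas and their negations are $\Sigma$-formulas; if $\phi,\psi$ are $\Sigma$-formulas then so are $\phi\vee\psi$, $\phi\wedge\psi$, $\exists x\sqsubseteq t\,\phi$, $\forall x\sqsubseteq t\,\phi$, $\exists x\,\phi$, where $x$ does not occur in $t$. *)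

(* Defs.v *)
From mathcomp Require Import all_boot.

Set Implicit Arguments.
Unset Strict Implicit.
Unset Printing Implicit Defensive.

(* The set H of variable-free terms over the constant Bot and binary Node. *)
Inductive term : Type :=
| Bot
| Node (t1 t2 : term).

Fixpoint subterm (s t : term) : Prop :=
  s = t \/
  match t with
  | Bot => False
  | Node t1 t2 => subterm s t1 \/ subterm s t2
  end.

(* First-order formulas, with equality, over one binary relation symbol.
   There are no function symbols, so the terms of the object language are
   exactly its variables, which are named by natural numbers. *)
Inductive formula : Type :=
| FEq (x y : nat)
| FSub (x y : nat)
| FNeg (p : formula)
| FAnd (p q : formula)
| FOr (p q : formula)
| FImp (p q : formula)
| FEx (x : nat) (p : formula)
| FAll (x : nat) (p : formula).

Definition FBEx (x t : nat) (p : formula) : formula := FEx x (FAnd (FSub x t) p).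
Definition FBAll (x t : nat) (p : formula) : formula := FAll x (FImp (FSub x t) p).

(* The side condition "x does not occur in t" reads x != t, t being a
   variable. *)
Inductive Sigma : formula -> Prop :=
| Sigma_Eq x y : Sigma (FEq x y)
| Sigma_Sub x y : Sigma (FSub x y)
| Sigma_NEq x y : Sigma (FNeg (FEq x y))
| Sigma_NSub x y : Sigma (FNeg (FSub x y))
| Sigma_Or p q : Sigma p -> Sigma q -> Sigma (FOr p q)
| Sigma_And p q : Sigma p -> Sigma q -> Sigma (FAnd p q)
| Sigma_BEx x t p : x != t -> Sigma p -> Sigma (FBEx x t p)
| Sigma_BAll x t p : x != t -> Sigma p -> Sigma (FBAll x t p)
| Sigma_Ex x p : Sigma p -> Sigma (FEx x p).

Fixpoint free_vars (p : formula) : seq nat :=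
  match p with
  | FEq x y | FSub x y => [:: x; y]
  | FNeg p => free_vars p
  | FAnd p q | FOr p q | FImp p q => free_vars p ++ free_vars q
  | FEx x p | FAll x p => [seq y <- free_vars p | y != x]
  end.

Definition sentence (p : formula) : Prop := free_vars p = [::].

Definition update (M : Type) (e : nat -> M) (x : nat) (a : M) : nat -> M :=
  fun y => if y == x then a else e y.

Fixpoint sat (M : Type) (R : M -> M -> Prop) (e : nat -> M) (p : formula)
    : Prop :=
  match p with
  | FEq x y => e x = e y
  | FSub x y => R (e x) (e y)
  | FNeg p => ~ sat R e p
  | FAnd p q => sat R e p /\ sat R e q
  | FOr p q => sat R e p \/ sat R e q
  | FImp p q => sat R e p -> sat R e q
  | FEx x p => exists a : M, sat R (update e x a) p
  | FAll x p => forall a : M, sat R (update e x a) p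
  end.

Definition holds (M : Type) (R : M -> M -> Prop) (p : formula) : Prop :=
  forall e : nat -> M, sat R e p.

Definition Sigma_theory (M : Type) (R : M -> M -> Prop) (p : formula) : Prop :=
  [/\ Sigma p, sentence p & holds R p].

(* Partial recursive functions of arity n.  PrimRec recurses on the first
   argument; Mu minimises over the first argument. *)
Inductive recfun : nat -> Type :=
| Zero n : recfun n
| Succ : recfun 1
| Proj n (i : 'I_n) : recfun n
| Comp k n (f : recfun k) (g : 'I_k -> recfun n) : recfun n
| PrimRec n (f : recfun n) (g : recfun n.+2) : recfun n.+1
| Mu n (f : recfun n.+1) : recfun n.

(* computes f v y: f is defined at v, with value y.  In the PrimRec case,
   s i is the value of the function at (i, behead v). *)
Fixpoint computes (n : nat) (f : recfun n) : n.-tuple nat -> nat -> Prop :=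
  match f in recfun n return n.-tuple nat -> nat -> Prop with
  | Zero n => fun _ y => y = 0
  | Succ => fun v y => y = (thead v).+1
  | Proj n i => fun v y => y = tnth v i
  | Comp k n f g => fun v y =>
      exists2 w : k.-tuple nat,
        forall i, computes (g i) v (tnth w i) & computes f w y
  | PrimRec n f g => fun v y =>
      exists s : nat -> nat,
        [/\ computes f [tuple of behead v] (s 0),
            forall i, i < thead v ->
              computes g [tuple of [:: i, s i & behead v]] (s i.+1)
          & y = s (thead v)]
  | Mu n f => fun v y =>
      computes f [tuple of y :: v] 0 /\
      forall i, i < y -> exists k, computes f [tuple of i :: v] k.+1
  end.

Definition recursive (A : nat -> Prop) : Prop :=
  exists f : recfun 1, forall n,
    (A n -> computes f [tuple n] 1) /\ (~ A n -> computes f [tuple n] 0).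

(* Cantor's pairing function. *)
Definition cpair (m n : nat) : nat := ((m + n) * (m + n).+1)./2 + n.

Fixpoint godel (p : formula) : nat :=
  match p with
  | FEq x y => cpair 0 (cpair x y)
  | FSub x y => cpair 1 (cpair x y)
  | FNeg p => cpair 2 (godel p)
  | FAnd p q => cpair 3 (cpair (godel p) (godel q))
  | FOr p q => cpair 4 (cpair (godel p) (godel q))
  | FImp p q => cpair 5 (cpair (godel p) (godel q))
  | FEx x p => cpair 6 (cpair x (godel p))
  | FAll x p => cpair 7 (cpair x (godel p))
  end.

Lemma cpair_inj m n m' n' : cpair m n = cpair m' n' -> m = m' /\ n = n'.
Proof.
have tri s : (s.+1 * s.+2)./2 = (s * s.+1)./2 + s.+1.
  have -> : s.+1 * s.+2 = s * s.+1 + s.+1.*2.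
    by rewrite -mul2n -mulnDl addn2 mulnC.
  by rewrite halfD odd_double andbF doubleK.
have tri_le a b : a <= b -> (a * a.+1)./2 <= (b * b.+1)./2.
  by move=> ab; apply: half_leq; apply: leq_mul.
have aux a b a' b' : cpair a b = cpair a' b' -> a + b <= a' + b'.
  rewrite /cpair leqNgt => E; apply/negP => /tri_le; rewrite tri => L.
  have: (((a' + b') * (a' + b').+1)./2 + b' < ((a + b) * (a + b).+1)./2 + b).
    apply: leq_trans (leq_addr _ _); apply: leq_trans L.
    by rewrite -addnS leq_add2l ltnS leq_addl.
  by rewrite E ltnn.
move=> E; have S : m + n = m' + n'.
  by apply/eqP; rewrite eqn_leq (aux _ _ _ _ E) (aux _ _ _ _ (esym E)).
move: E; rewrite /cpair S => /addnI En; split=> //.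
by move: S; rewrite En => /addIn.
Qed.

Lemma godel_inj : injective godel.
Proof.
elim=> [x y|x y|p IHp|p IHp q IHq|p IHp q IHq|p IHp q IHq|x p IHp|x p IHp];
  case=> [a b|a b|a|a b|a b|a b|a b|a b] //= /cpair_inj [] // _;
  do ?[by move/IHp-> | case/cpair_inj=> E1 E2];
  by rewrite ?(IHp _ E1) ?(IHp _ E2) ?(IHq _ E2) ?E1 ?E2.
Qed.

Definition decidable_theory (T : formula -> Prop) : Prop :=
  recursive (fun n => exists2 p, T p & godel p = n).

(* Main.v *)
(* Above a fixed term c, the subterms of a chain (a term whose subterms are
   pairwise comparable) form an initial segment of the natural numbers with a
   definable successor, and every chain extends to longer ones.  If c, q and r
   are pairwise incomparable, the subterms of Node (Node q i) (Node r v) determine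
   i and v even though the subterm order does not see the order of siblings, so
   finite functions are coded by single terms.  Hence graphs of recursive
   functions are Sigma-definable: primitive recursion guesses the course of
   values, and minimisation only needs a bounded universal quantifier.
   Diagonalization then refutes a recursive decision procedure f: a Sigma-formula
   p(x0, x1) expressing f(diagonal x0) = 0, instantiated at its own code, is true
   iff f rejects it. *)

From mathcomp Require Import all_boot zify.
From Stdlib Require Import Classical.
Require Import Defs.

Set Implicit Arguments.
Unset Strict Implicit.
Unset Printing Implicit Defensive.

Local Notation "s <: t" := (subterm s t) (at level 70, no associativity).
Local Notation env := (nat -> term).

(** * The subterm order *)

Lemma sub_refl t : t <: t.
Proof. by case: t => *; left. Qed.

Lemma sub_trans s t u : s <: t -> t <: u -> s <: u.
Proof.
move=> st; elim: u => [[<-|]//|u1 IH1 u2 IH2 [<-//|[/IH1|/IH2] H]].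
  by right; left.
by right; right.
Qed.

Fixpoint height (t : term) : nat :=
  if t is Node t1 t2 then (maxn (height t1) (height t2)).+1 else 0.

Lemma sub_height s t : s <: t -> s = t \/ height s < height t.
Proof.
elim: t => [[->|[]]|t1 IH1 t2 IH2 /= [->|[/IH1|/IH2] [->|H]]]; [by left..| | | |];
  right; lia.
Qed.

Lemma sub_le s t : s <: t -> height s <= height t.
Proof. by case/sub_height => [->//|/ltnW]. Qed.

Lemma sub_anti s t : s <: t -> t <: s -> s = t.
Proof. by case/sub_height => // lt /sub_le; lia. Qed.

Lemma sub_left a b : a <: Node a b.
Proof. by right; left; apply: sub_refl. Qed.

Lemma sub_right a b : b <: Node a b.
Proof. by right; right; apply: sub_refl. Qed.

(** The height of a node exceeds the larger height of its children by exactly one, so no value is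
    skipped on the way down: unless [k] is the height of the root, some child is still high
    enough. *)
Lemma exists_height t k : k <= height t -> exists2 s, s <: t & height s = k.
Proof.
elim: t => [|t1 IH1 t2 IH2] kt; first by case: k kt => // _; exists Bot => //; left.
have [->|lt] := eqVneq k (height (Node t1 t2)).
  by exists (Node t1 t2) => //; apply: sub_refl.
have [s st sk] : exists2 s, s <: t1 \/ s <: t2 & height s = k.
  have [k1|k1] := leqP k (height t1).
    by have [s] := IH1 k1; exists s => //; left.
  have [|s] := IH2; first by move: kt lt => /=; lia.
  by exists s => //; right.
by exists s => //; right.
Qed.

Definition chain (t : term) : Prop :=
  forall s, s <: t -> forall u, u <: t -> s <: u \/ u <: s.

Lemma chain_double t : chain t -> chain (Node t t).
Proof.
move=> ct s [->|st] u [->|ut]; [by left; apply: sub_refl|..].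
- by right; right.
- by left; right.
- by apply: ct; tauto.
Qed.

Definition grow (k : nat) (t : term) : term := iter k (fun s => Node s s) t.

Lemma sub_grow k t : t <: grow k t.
Proof.
by elim: k => [|k IH]; [apply: sub_refl | apply: sub_trans IH (sub_left _ _)].
Qed.

Lemma height_grow k t : height (grow k t) = k + height t.
Proof. by elim: k => //= k ->; rewrite maxnn addSn. Qed.

Lemma chain_grow k t : chain t -> chain (grow k t).
Proof. by move=> ct; elim: k => //= k; apply: chain_double. Qed.

(** A proper subterm has smaller height, so comparable terms of equal height coincide. Height is
    thus a coordinate on a chain. *)
Lemma chain_inj N x y :
  chain N -> x <: N -> y <: N -> height x = height y -> x = y.
Proof. by move=> cN xN yN E; case: (cN x xN y yN) => /sub_height[]//; lia. Qed.

Lemma chain_le N x y :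
  chain N -> x <: N -> y <: N -> height x <= height y -> x <: y.
Proof.
move=> cN xN yN E; case: (cN x xN y yN) => // /sub_height[->|]; last by lia.
exact: sub_refl.
Qed.

Definition cover (x y : term) : Prop :=
  x <: y /\ x <> y /\ forall z, z <: y -> z = y \/ z <: x.

(** Some subterm [z] of [y] has height one less than [y]. It is not [y], so it lies under [x], which
    leaves no room between the two heights. *)
Lemma cover_height x y : cover x y -> height y = (height x).+1.
Proof.
case=> /sub_height[-> []//|lt] [_ max].
have [z zy zh] : exists2 z, z <: y & height z = (height y).-1.
  by apply: exists_height; lia.
by case: (max z zy) => [E|/sub_le]; [move: zh; rewrite E|]; lia.
Qed.

Lemma chain_cover N x y : chain N -> x <: N -> y <: N ->
  height y = (height x).+1 -> cover x y.
Proof.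
move=> cN xN yN E; split; first by apply: chain_le cN _ _ _ => //; lia.
split=> [xy|z zy]; first by move: E; rewrite xy; lia.
have zN := sub_trans zy yN.
have [zx|zx] := leqP (height z) (height x); first by right; apply: chain_le cN _ _ _.
by left; apply: chain_inj cN zN yN _; move/sub_le: zy; lia.
Qed.

(** * Coding finite graphs *)

(** An order-theoretic substitute for [a = Node q i], blind to the order of siblings. It admits
    degenerate solutions such as [a = i] when [q] is a subterm of [i]; incomparability of [q] and
    [i] excludes them. *)
Definition half (q a i : term) : Prop :=
  q <: a /\ i <: a /\ forall y, y <: a -> y = a \/ y <: q \/ y <: i.

Definition pair (q r p i v : term) : Prop :=
  exists a, a <: p /\ exists b, b <: p /\
    half q a i /\ half r b v /\ forall y, y <: p -> y = p \/ y <: a \/ y <: b.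

Definition codes (q r W i v : term) : Prop := exists p, p <: W /\ pair q r p i v.

Definition apart (s t : term) : Prop := ~ s <: t /\ ~ t <: s.

Lemma half_node q i : half q (Node q i) i.
Proof.
split; first exact: sub_left.
by split=> [|y]; [apply: sub_right | case; tauto].
Qed.

(** A subterm [r] of [a] would be [a] itself, which contains [q], or lie under [q] or [i]. A half
    marked by [q] therefore misses the other marker, and this tells the two halves of a pair
    apart. *)
Lemma half_apart q r a i : apart q r -> apart r i -> half q a i -> ~ r <: a.
Proof.
move=> [qr rq] [ri _] [qa [_ max]] ra.
by case: (max r ra) => [ra'|[]//]; apply: qr; rewrite ra'.
Qed.

Lemma half_inj q a i j :
  apart q i -> apart q j -> half q a i -> half q a j -> i = j.
Proof.
move=> [qi iq] [qj jq] [qa [ia maxi]] [_ [ja maxj]]; apply: sub_anti.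
  by case: (maxj i ia) => [E|[]//]; case: qi; rewrite E.
by case: (maxi j ja) => [E|[]//]; case: qj; rewrite E.
Qed.

Lemma pair_sym q r p i v : pair q r p i v -> pair r q p v i.
Proof.
move=> [a [ap [b [bp [ha [hb max]]]]]]; exists b; split=> //; exists a.
by do 3!split=> //; move=> y /max; tauto.
Qed.

Lemma pair_node q r i v : pair q r (Node (Node q i) (Node r v)) i v.
Proof.
exists (Node q i); split; first exact: sub_left.
exists (Node r v); split; first exact: sub_right.
by do 2![split; first exact: half_node]; move=> y [->|H]; [left | right].
Qed.

Definition loose (q r i : term) : Prop := apart q i /\ apart r i.

(** The half [a] is a subterm of [p], but it is not [p], which contains [r], and not under [b'],
    which misses [q]. So it lies under [a']; by symmetry [a = a'], and [half_inj] applies. *)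
Lemma pair_inj_l q r p i v i' v' : apart q r ->
  loose q r i -> loose q r v -> loose q r i' -> loose q r v' ->
  pair q r p i v -> pair q r p i' v' -> i = i'.
Proof.
move=> qr; have rq : apart r q by case: qr.
move=> [qi ri] [qv rv] [qi' ri'] [qv' rv'].
move=> [a [ap [b [bp [ha [hb max]]]]]] [a' [ap' [b' [bp' [ha' [hb' max']]]]]].
have aa' : a = a'.
  apply: sub_anti.
  - case: (max' a ap) => [E|[//|ab]].
      case: (half_apart qr ri ha); rewrite E; exact: sub_trans (proj1 hb) bp.
    case: (half_apart rq qv' hb'); exact: sub_trans (proj1 ha) ab.
  - case: (max a' ap') => [E|[//|ab]].
      case: (half_apart qr ri' ha'); rewrite E; exact: sub_trans (proj1 hb') bp'.
    case: (half_apart rq qv hb); exact: sub_trans (proj1 ha') ab.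
by move: ha'; rewrite -aa'; apply: half_inj ha.
Qed.

Lemma looseC q r i : loose q r i -> loose r q i.
Proof. by case. Qed.

Lemma pair_inj q r p i v i' v' : apart q r ->
  loose q r i -> loose q r v -> loose q r i' -> loose q r v' ->
  pair q r p i v -> pair q r p i' v' -> i = i' /\ v = v'.
Proof.
move=> qr li lv li' lv' P P'; split; first exact: pair_inj_l P P'.
by apply: (@pair_inj_l r q p v i v' i');
  [case: qr | apply: looseC.. | apply: pair_sym | apply: pair_sym].
Qed.

Lemma codes_Bot q r i v : apart q r -> ~ codes q r Bot i v.
Proof.
move=> [qr _] [p [[->|[]] [a [[->|[]] [b [[->|[]] [[qB _] [[rB _] _]]]]]]]].
by case: qB rB qr => [->|[]] [->|[]] []; apply: sub_refl.
Qed.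

(** Adding an entry creates no spurious ones: every coded pair contains both markers, and apart from
    subterms of [W] only [Q] can then be a pair. *)
Lemma codes_Node q r W i v x w : apart q r ->
  loose q r i -> loose q r v -> loose q r x -> loose q r w ->
  codes q r (Node (Node (Node q x) (Node r w)) W) i v <->
  (i = x /\ v = w) \/ codes q r W i v.
Proof.
move=> qr li lv lx lw; have rq : apart r q by case: qr.
split; last first.
  case=> [[-> ->]|[p [pW P]]]; [|by exists p; split=> //; right; right].
  exists (Node (Node q x) (Node r w)); split; [exact: sub_left | exact: pair_node].
move=> [p [pW P]]; have [a [ap [b [bp [ha [hb max]]]]]] := P.
have qa := half_apart qr (proj2 li) ha; have rb := half_apart rq (proj1 lv) hb.
set Q := Node (Node q x) (Node r w) in pW.
have qQ : q <: Q by apply: sub_trans (sub_left _ _); apply: sub_left.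
have rQ : r <: Q by apply: sub_trans (sub_right _ _); apply: sub_left.
case: pW => [E|[pQ|pW]]; last by right; exists p.
  (* If [p] were the whole term, its child [Q], which contains both markers, would lie in one half
     of [p], which misses a marker. *)
  case: (max Q); first by rewrite E; apply: sub_left.
    by rewrite E => /(congr1 height) /=; lia.
  by case=> [Qa|Qb]; [case: qa | case: rb]; [apply: sub_trans rQ Qa | apply: sub_trans qQ Qb].
left; apply: (pair_inj qr li lv lx lw P).
have -> : p = Q; last exact: pair_node.
(* A proper subterm of [Q] lies in one of its two halves and so misses a marker that [p]
   contains. *)
case: pQ => [//|[pq|pr]].
  have rp := sub_trans (sub_trans (proj1 hb) bp) (pq : p <: Node q x).
  by case: (half_apart qr (proj2 lx) (half_node q x) rp).
have qp := sub_trans (sub_trans (proj1 ha) ap) (pr : p <: Node r w).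
by case: (half_apart rq (proj1 lw) (half_node r w) qp).
Qed.

(** * Sigma-definable relations *)

(* Coordinates of the environment are de Bruijn indices of R; quantifying over
   all s builds closure under renaming of variables into the definition, and
   the bound k provides the fresh variable k for the quantifier rules. *)
Definition Sdef (R : env -> Prop) : Prop :=
  forall k (s : nat -> nat), (forall i, s i < k) ->
  exists p, [/\ Sigma p, all (fun x => x < k) (free_vars p) &
    forall e e', (forall i, e' i = e (s i)) -> sat subterm e p <-> R e'].

(** Variables are given as functions of the environment, so that [e i] and its shift [e i.+1] under
    a binder fit the same closure rules. *)
Definition isvar (Y : env -> term) : Prop := exists i, forall e, Y e = e i.

Lemma isvar_proj i : isvar (fun e => e i).
Proof. by exists i. Qed.

Lemma Sdef_iff R R' : (forall e, R e <-> R' e) -> Sdef R -> Sdef R'.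
Proof.
move=> RR' SR k s /SR[p [Sp fp H]]; exists p; split=> // e e' ee'.
by rewrite (H _ _ ee') RR'.
Qed.

Lemma Sdef_eq Y Z : isvar Y -> isvar Z -> Sdef (fun e => Y e = Z e).
Proof.
move=> [i Yi] [j Zj] k s sk; exists (FEq (s i) (s j)); split=> [||e e' ee'].
- by constructor.
- by rewrite /= !sk.
- by rewrite Yi Zj !ee'.
Qed.

Lemma Sdef_neq Y Z : isvar Y -> isvar Z -> Sdef (fun e => Y e <> Z e).
Proof.
move=> [i Yi] [j Zj] k s sk; exists (FNeg (FEq (s i) (s j))); split=> [||e e' ee'].
- by constructor.
- by rewrite /= !sk.
- by rewrite Yi Zj !ee'.
Qed.

Lemma Sdef_sub Y Z : isvar Y -> isvar Z -> Sdef (fun e => Y e <: Z e).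
Proof.
move=> [i Yi] [j Zj] k s sk; exists (FSub (s i) (s j)); split=> [||e e' ee'].
- by constructor.
- by rewrite /= !sk.
- by rewrite Yi Zj !ee'.
Qed.

Lemma Sdef_nsub Y Z : isvar Y -> isvar Z -> Sdef (fun e => ~ Y e <: Z e).
Proof.
move=> [i Yi] [j Zj] k s sk; exists (FNeg (FSub (s i) (s j))); split=> [||e e' ee'].
- by constructor.
- by rewrite /= !sk.
- by rewrite Yi Zj !ee'.
Qed.

Lemma Sdef_and R R' : Sdef R -> Sdef R' -> Sdef (fun e => R e /\ R' e).
Proof.
move=> SR SR' k s sk; have [p [Sp fp H]] := SR k s sk.
have [p' [Sp' fp' H']] := SR' k s sk; exists (FAnd p p').
split=> [||e e' ee'] /=; first by constructor.
  by rewrite all_cat fp.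
by rewrite (H _ _ ee') (H' _ _ ee').
Qed.

Lemma Sdef_or R R' : Sdef R -> Sdef R' -> Sdef (fun e => R e \/ R' e).
Proof.
move=> SR SR' k s sk; have [p [Sp fp H]] := SR k s sk.
have [p' [Sp' fp' H']] := SR' k s sk; exists (FOr p p').
split=> [||e e' ee'] /=; first by constructor.
  by rewrite all_cat fp.
by rewrite (H _ _ ee') (H' _ _ ee').
Qed.

(** The bound variable is the fresh [k]: index 0 of the body is sent to [k] and index [j.+1] to
    [s j]. As every [s j] is below [k], updating at [k] leaves the other coordinates alone. *)
Lemma Sdef_bind (B : env -> term -> Prop) :
  Sdef (fun e => B (fun i => e i.+1) (e 0)) ->
  forall k (s : nat -> nat), (forall i, s i < k) ->
  exists p, [/\ Sigma p, all (fun x => x < k) [seq y <- free_vars p | y != k] &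
    forall e e', (forall i, e' i = e (s i)) ->
    forall a, sat subterm (update e k a) p <-> B e' a].
Proof.
move=> SB k s sk; case: (SB k.+1 (fun i => if i is j.+1 then s j else k)).
  by case=> // i; apply: ltnW; rewrite ltnS.
move=> p [Sp fp H]; exists p; split=> // [|e e' ee' a].
  apply/allP => x; rewrite mem_filter => /andP[xk /(allP fp)].
  by rewrite ltnS ltn_neqAle xk.
rewrite (H _ (fun i => if i is j.+1 then e' j else a)) //.
by case=> [|i]; rewrite /update ?eqxx // ltn_eqF.
Qed.

Lemma Sdef_ex (B : env -> term -> Prop) :
  Sdef (fun e => B (fun i => e i.+1) (e 0)) -> Sdef (fun e => exists a, B e a).
Proof.
move=> /Sdef_bind SB k s /SB[p [Sp fp H]]; exists (FEx k p).
split=> // [|e e' /H{}H /=]; first by constructor.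
by split=> -[a /H]; exists a => //; apply/H.
Qed.

Lemma Sdef_all Y (B : env -> term -> Prop) : isvar Y ->
  Sdef (fun e => B (fun i => e i.+1) (e 0)) ->
  Sdef (fun e => forall a, a <: Y e -> B e a).
Proof.
move=> [j Yj] /Sdef_bind SB k s sk; have [p [Sp fp H]] := SB k s sk.
have jk : (s j == k) = false by rewrite ltn_eqF.
exists (FBAll k (s j) p); split=> [||e e' ee' /=].
- by constructor; rewrite // eq_sym jk.
- by rewrite /= eqxx jk /= sk.
- rewrite Yj ee'; split=> Q a; have := Q a; rewrite {1 2}/update eqxx jk => {}Q.
  + by move/Q/(H _ _ ee').
  + by move/Q=> ?; apply/(H _ _ ee').
Qed.

(* Both R and its negation are Sigma-definable, so R may be a premise. *)
Definition Ddef (R : env -> Prop) : Prop := Sdef R /\ Sdef (fun e => ~ R e).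

Lemma Ddef_eq Y Z : isvar Y -> isvar Z -> Ddef (fun e => Y e = Z e).
Proof. by split; [apply: Sdef_eq | apply: Sdef_neq]. Qed.

Lemma Ddef_sub Y Z : isvar Y -> isvar Z -> Ddef (fun e => Y e <: Z e).
Proof. by split; [apply: Sdef_sub | apply: Sdef_nsub]. Qed.

Lemma Ddef_not R : Ddef R -> Ddef (fun e => ~ R e).
Proof.
by case=> SR NR; split=> //; apply: Sdef_iff SR => e; split; [tauto | apply: NNPP].
Qed.

Lemma Ddef_and R R' : Ddef R -> Ddef R' -> Ddef (fun e => R e /\ R' e).
Proof.
move=> [SR NR] [SR' NR']; split; first exact: Sdef_and.
by apply: Sdef_iff (Sdef_or NR NR') => e; tauto.
Qed.

Lemma Ddef_or R R' : Ddef R -> Ddef R' -> Ddef (fun e => R e \/ R' e).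
Proof.
move=> [SR NR] [SR' NR']; split; first exact: Sdef_or.
by apply: Sdef_iff (Sdef_and NR NR') => e; tauto.
Qed.

Lemma Ddef_ex Y (B : env -> term -> Prop) : isvar Y ->
  Ddef (fun e => B (fun i => e i.+1) (e 0)) ->
  Ddef (fun e => exists a, a <: Y e /\ B e a).
Proof.
move=> [j Yj] [SB NB]; split.
  apply: Sdef_ex; apply: Sdef_and => //.
  by apply: Sdef_sub; [exists 0 | exists j.+1 => e; rewrite Yj].
have V : isvar Y by exists j.
apply: Sdef_iff (Sdef_all (B := fun e a => ~ B e a) V NB) => e.
by split=> [H [a [/H]]|H a aY Ba] //; apply: H; exists a.
Qed.

Lemma Ddef_all Y (B : env -> term -> Prop) : isvar Y ->
  Ddef (fun e => B (fun i => e i.+1) (e 0)) ->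
  Ddef (fun e => forall a, a <: Y e -> B e a).
Proof.
move=> V [SB NB]; split; first exact: Sdef_all.
have [D _] := Ddef_ex (B := fun e a => ~ B e a) V (Ddef_not (conj SB NB)).
apply: Sdef_iff D => e; split=> [[a [aY nB]] H|H]; first exact: nB (H a aY).
by apply: NNPP => nE; apply: H => a aY; apply: NNPP => nB; apply: nE; exists a.
Qed.

Lemma Sdef_imp R R' : Ddef R -> Sdef R' -> Sdef (fun e => R e -> R' e).
Proof.
move=> [_ NR] SR'; apply: Sdef_iff (Sdef_or NR SR') => e.
by have := classic (R e); tauto.
Qed.

Lemma Sdef_forall_ord k (P : 'I_k -> env -> Prop) :
  (forall i, Sdef (P i)) -> Sdef (fun e => forall i, P i e).
Proof.
move=> SP; suff H (s : seq 'I_k) : Sdef (fun e => forall i, i \in s -> P i e).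
  apply: Sdef_iff (H (enum 'I_k)) => e.
  by split=> Q i; move: (Q i); rewrite mem_enum; auto.
elim: s => [|i s IH].
  (* The empty conjunction is expressed by an equation of a variable with itself. *)
  by apply: Sdef_iff (Sdef_eq (isvar_proj 0) (isvar_proj 0)) => e; split.
apply: Sdef_iff (Sdef_and (SP i) IH) => e.
split=> [[Pi Ps] j|Ps]; first by rewrite inE => /predU1P[->|/Ps].
by split=> [|j js]; apply: Ps; rewrite inE ?eqxx ?js ?orbT.
Qed.

(** * Lists of variables and blocks of quantifiers *)

Definition isvars (X : env -> seq term) : Prop :=
  exists ix : seq nat, forall e, X e = [seq e i | i <- ix].

Lemma isvars_nil : isvars (fun _ => [::]).
Proof. by exists [::]. Qed.

Lemma isvars_map (t : nat -> nat) ix : isvars (fun e => [seq e (t i) | i <- ix]).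
Proof. by exists [seq t i | i <- ix] => e; rewrite -map_comp. Qed.

Lemma isvars_cons Y X : isvar Y -> isvars X -> isvars (fun e => Y e :: X e).
Proof. by move=> [i Yi] [ix Xix]; exists (i :: ix) => e; rewrite Yi Xix. Qed.

Lemma isvars_behead X : isvars X -> isvars (fun e => behead (X e)).
Proof. by move=> [ix Xix]; exists (behead ix) => e; rewrite Xix behead_map. Qed.

(** The default is itself a variable, so out-of-range entries are covered too. *)
Lemma isvar_nth c X i : isvars X -> isvar (fun e => nth (e c) (X e) i).
Proof.
move=> [ix Xix]; exists (nth c ix i) => e; rewrite {}Xix.
by elim: ix i => [|j ix IH] [|i] //=.
Qed.

Lemma isvar_head c X : isvars X -> isvar (fun e => head (e c) (X e)).
Proof.
by case/(isvar_nth c 0) => i H; exists i => e; rewrite -nth0.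
Qed.

(** The hypothesis allows any renaming [t] because each of the [k] quantifiers shifts the remaining
    variables once more. *)
Lemma Sdef_ex_seq k (B : env -> seq term -> Prop) :
  (forall t X, isvars X -> Sdef (fun e => B (fun i => e (t i)) (X e))) ->
  Sdef (fun e => exists w, size w = k /\ B e w).
Proof.
elim: k B => [|k IH] B SB.
  apply: Sdef_iff (SB id _ isvars_nil) => e.
  by split=> [Be|[w [/size0nil->]] //]; exists [::].
have {IH} S : Sdef (fun e => exists a w, size w = k /\ B e (a :: w)).
  apply: Sdef_ex; apply: (IH (fun e w => B (fun i => e i.+1) (e 0 :: w))) => t X VX.
  by apply: (SB (fun i => t i.+1)); apply: isvars_cons => //; apply: isvar_proj.
apply: Sdef_iff S => e; split=> [[a [w [<- Bw]]]|[[|a w] [//= [wk] Bw]]].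
  by exists (a :: w).
by exists a, w.
Qed.

(** * Definability of chains, covers and codes *)

Lemma Ddef_chain i : Ddef (fun e => chain (e i)).
Proof.
by do 2![apply: Ddef_all; first exact: isvar_proj];
  apply: Ddef_or; apply: Ddef_sub; apply: isvar_proj.
Qed.

Lemma Sdef_cover Y Z : isvar Y -> isvar Z -> Sdef (fun e => cover (Y e) (Z e)).
Proof.
move=> [i Yi] [j Zj]; suff [H _] : Ddef (fun e => cover (e i) (e j)).
  by apply: Sdef_iff H => e; rewrite Yi Zj.
apply: Ddef_and; first by apply: Ddef_sub; apply: isvar_proj.
apply: Ddef_and; first by apply: Ddef_not; apply: Ddef_eq; apply: isvar_proj.
apply: Ddef_all; first exact: isvar_proj.
by apply: Ddef_or; [apply: Ddef_eq | apply: Ddef_sub]; apply: isvar_proj.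
Qed.

Lemma Ddef_half q a i : Ddef (fun e => half (e q) (e a) (e i)).
Proof.
do 2![apply: Ddef_and; first by apply: Ddef_sub; apply: isvar_proj].
apply: Ddef_all; first exact: isvar_proj.
apply: Ddef_or; first by apply: Ddef_eq; apply: isvar_proj.
by apply: Ddef_or; apply: Ddef_sub; apply: isvar_proj.
Qed.

Lemma Ddef_codes q r W i v : Ddef (fun e => codes (e q) (e r) (e W) (e i) (e v)).
Proof.
do 3![apply: Ddef_ex; first exact: isvar_proj].
do 2![apply: Ddef_and; first exact: Ddef_half].
apply: Ddef_all; first exact: isvar_proj.
apply: Ddef_or; first by apply: Ddef_eq; apply: isvar_proj.
by apply: Ddef_or; apply: Ddef_sub; apply: isvar_proj.
Qed.

Lemma Sdef_codes q r W I V : isvar I -> isvar V ->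
  Sdef (fun e => codes (e q) (e r) (e W) (I e) (V e)).
Proof.
move=> [i Ii] [v Vv]; have [H _] := Ddef_codes q r W i v.
by apply: Sdef_iff H => e; rewrite Ii Vv.
Qed.

(** * Recursive functions on chains *)

Definition within (c N x : term) : Prop := c <: x /\ x <: N.

(* A number n is represented by the subterm of the chain N lying n steps above
   c; the intermediate values of a computation may need a longer chain N'. *)
Fixpoint rel n (f : recfun n) (c q r : term) : term -> seq term -> term -> Prop :=
  match f with
  | Zero _ => fun N X y => y = c
  | Succ => fun N X y => cover (head c X) y
  | Proj _ i => fun N X y => y = nth c X i
  | Comp k _ f g => fun N X y => exists N', (N <: N' /\ chain N') /\
      exists w, size w = k /\
        ((forall i : 'I_k, within c N' (nth c w i) /\
           rel (g i) c q r N' X (nth c w i)) /\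
         rel f c q r N' w y)
  | PrimRec _ f g => fun N X y => exists N', (N <: N' /\ chain N') /\
      exists W, codes q r W (head c X) y /\
        forall i, i <: N' -> forall v, v <: N' ->
        (c <: i /\ c <: v) /\ codes q r W i v ->
        (i = c /\ rel f c q r N' (behead X) v) \/
        exists j, (within c N' j /\ cover j i) /\
        exists u, within c N' u /\ (codes q r W j u /\
          rel g c q r N' [:: j, u & behead X] v)
  | Mu _ f => fun N X y => rel f c q r N (y :: X) c /\
      forall i, i <: y -> c <: i /\ i <> y ->
      exists N', (N <: N' /\ chain N') /\
      exists k, (within c N' k /\ k <> c) /\ rel f c q r N' (i :: X) k
  end.

Lemma Sdef_within c N Y : isvar Y -> Sdef (fun e => within (e c) (e N) (Y e)).
Proof.
by move=> V; apply: Sdef_and; apply: Sdef_sub => //; apply: isvar_proj.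
Qed.

Lemma Sdef_ext N M : Sdef (fun e => e N <: e M /\ chain (e M)).
Proof.
apply: Sdef_and; first by apply: Sdef_sub; apply: isvar_proj.
by case: (Ddef_chain M).
Qed.

Lemma Sdef_rel n (f : recfun n) c q r N X Y : isvars X -> isvar Y ->
  Sdef (fun e => rel f (e c) (e q) (e r) (e N) (X e) (Y e)).
Proof.
elim: n / f c q r N X Y => [n||n i|k n f IHf g IHg|n f IHf g IHg|n f IHf] c q r N X Y.
- by move=> _ V; apply: Sdef_eq => //; apply: isvar_proj.
- by move=> VX V; apply: Sdef_cover => //; apply: isvar_head.
- by move=> VX V; apply: Sdef_eq => //; apply: isvar_nth.
- move=> [ix Xix] [y Yy].
  (* With explicit coordinates for [X] and [Y], shifting the environment under a binder is mere
     computation. *)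
  suff S : Sdef (fun e => rel (Comp f g) (e c) (e q) (e r) (e N) [seq e i | i <- ix] (e y)).
    by apply: Sdef_iff S => e; rewrite Xix Yy.
  apply: Sdef_ex; apply: Sdef_and; first exact: Sdef_ext.
  apply: (@Sdef_ex_seq k (fun e w => (forall i : 'I_k, within (e c.+1) (e 0) (nth (e c.+1) w i) /\
           rel (g i) (e c.+1) (e q.+1) (e r.+1) (e 0) [seq e i.+1 | i <- ix] (nth (e c.+1) w i)) /\
         rel f (e c.+1) (e q.+1) (e r.+1) (e 0) w (e y.+1))) => t Z VZ.
  apply: Sdef_and; last by apply: IHf => //; apply: isvar_proj.
  apply: Sdef_forall_ord => i; apply: Sdef_and.
    by apply: Sdef_within; apply: isvar_nth.
  by apply: IHg; [apply: isvars_map | apply: isvar_nth].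
- move=> [ix Xix] [y Yy].
  suff S : Sdef (fun e => rel (PrimRec f g) (e c) (e q) (e r) (e N) [seq e i | i <- ix] (e y)).
    by apply: Sdef_iff S => e; rewrite Xix Yy.
  apply: Sdef_ex; apply: Sdef_and; first exact: Sdef_ext.
  apply: Sdef_ex; apply: Sdef_and.
    by apply: Sdef_codes; [apply: isvar_head; apply: isvars_map | apply: isvar_proj].
  do 2![apply: Sdef_all; first exact: isvar_proj].
  (* The premise has only bounded quantifiers, so its negation is available and the implication
     becomes a disjunction. *)
  apply: Sdef_imp.
    apply: Ddef_and; last exact: Ddef_codes.
    by apply: Ddef_and; apply: Ddef_sub; apply: isvar_proj.
  apply: Sdef_or.
    apply: Sdef_and; first by apply: Sdef_eq; apply: isvar_proj.
    by apply: IHf; [apply: isvars_behead; apply: isvars_map | apply: isvar_proj].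
  apply: Sdef_ex; apply: Sdef_and.
    apply: Sdef_and; first by apply: Sdef_within; apply: isvar_proj.
    by apply: Sdef_cover; apply: isvar_proj.
  apply: Sdef_ex; apply: Sdef_and; first by apply: Sdef_within; apply: isvar_proj.
  apply: Sdef_and; first by apply: Sdef_codes; apply: isvar_proj.
  apply: IHg; last exact: isvar_proj.
  do 2![apply: isvars_cons; first exact: isvar_proj].
  by apply: isvars_behead; apply: isvars_map.
- move=> [ix Xix] [y Yy].
  suff S : Sdef (fun e => rel (Mu f) (e c) (e q) (e r) (e N) [seq e i | i <- ix] (e y)).
    by apply: Sdef_iff S => e; rewrite Xix Yy.
  apply: Sdef_and.
    apply: IHf; last exact: isvar_proj.
    by apply: isvars_cons; [apply: isvar_proj | apply: isvars_map].
  apply: Sdef_all; first exact: isvar_proj.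
  apply: Sdef_imp.
    apply: Ddef_and; first by apply: Ddef_sub; apply: isvar_proj.
    by apply: Ddef_not; apply: Ddef_eq; apply: isvar_proj.
  apply: Sdef_ex; apply: Sdef_and; first exact: Sdef_ext.
  apply: Sdef_ex; apply: Sdef_and.
    apply: Sdef_and; first by apply: Sdef_within; apply: isvar_proj.
    by apply: Sdef_neq; apply: isvar_proj.
  apply: IHf; last exact: isvar_proj.
  by apply: isvars_cons; [apply: isvar_proj | apply: isvars_map].
Qed.

Lemma computes_inj n (f : recfun n) v y z : computes f v y -> computes f v z -> y = z.
Proof.
elim: n / f v y z => [n||n i|k n f IHf g IHg|n f IHf g IHg|n f IHf] v y z /=.
- by move=> -> ->.
- by move=> -> ->.
- by move=> -> ->.
- move=> [w gw fw] [w' gw' fw']; have E : w = w'.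
    by apply: eq_from_tnth => i; apply: IHg (gw i) (gw' i).
  by rewrite -E in fw'; apply: IHf fw fw'.
- move=> [s [s0 sS ->]] [s' [s0' sS' ->]].
  suff H k : k <= thead v -> s k = s' k by apply: H.
  elim: k => [|k IH] kv; first exact: IHf s0 s0'.
  have := sS k kv; rewrite (IH (ltnW kv)) => H; exact: IHg H (sS' k kv).
- move=> [fy Hy] [fz Hz].
  have [yz|yz|//] := ltngtP y z.
    by have [k H] := Hz y yz; have := IHf _ _ _ fy H.
  by have [k H] := Hy z yz; have := IHf _ _ _ fz H.
Qed.

Lemma computes_eq n (f : recfun n) (v w : n.-tuple nat) y :
  v = w :> seq nat -> computes f v y -> computes f w y.
Proof. by move/val_inj->. Qed.

(** On a chain, consecutive subterms differ by one in height, so this difference counts the covering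
    steps from [c] to [x]. *)
Definition num (c x : term) : nat := height x - height c.

Lemma num_self c : num c c = 0.
Proof. exact: subnn. Qed.

Lemma within_mono c N N' x : N <: N' -> within c N x -> within c N' x.
Proof. by move=> NN' [cx xN]; split=> //; apply: sub_trans NN'. Qed.

Lemma num_inj c N x y : chain N -> within c N x -> within c N y ->
  num c x = num c y -> x = y.
Proof.
move=> cN [cx xN] [cy yN] E; apply: chain_inj cN xN yN _.
by move: (sub_le cx) (sub_le cy) E; rewrite /num; lia.
Qed.

Lemma exists_num c N k : chain N -> c <: N -> k <= num c N ->
  exists2 x, within c N x & num c x = k.
Proof.
rewrite /num => cN sN kN; have := sub_le sN => le.
have [|x xN xk] := @exists_height N (height c + k); first by lia.
exists x; last by lia.
by split=> //; apply: chain_le cN _ _ _ => //; lia.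
Qed.

Lemma coverP c N x y : chain N -> within c N x -> within c N y ->
  cover x y <-> num c y = (num c x).+1.
Proof.
rewrite /num => cN [cx xN] [cy yN]; have := sub_le cx; have := sub_le cy => ly lx.
split=> [/cover_height|E]; first by lia.
by apply: chain_cover cN xN yN _; lia.
Qed.

Lemma num_le c N x : within c N x -> num c x <= num c N.
Proof. by case=> _ /sub_le; rewrite /num; lia. Qed.

Lemma num_lt c N x y : chain N -> within c N x -> within c N y ->
  num c x < num c y <-> x <: y /\ x <> y.
Proof.
rewrite /num => cN [cx xN] [cy yN]; have := sub_le cx; have := sub_le cy => ly lx.
split=> [lt|[/sub_height[//|]]]; last by lia.
split=> [|E]; last by move: lt; rewrite E ltnn.
by apply: chain_le cN _ _ _ => //; lia.
Qed.

(* Since c itself is within N, the default value makes the clause for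
   out-of-range indices harmless. *)
Definition reps (c N : term) (X : seq term) (v : seq nat) : Prop :=
  forall i, within c N (nth c X i) /\ num c (nth c X i) = nth 0 v i.

Lemma reps_mono c N N' X v : N <: N' -> reps c N X v -> reps c N' X v.
Proof. by move=> NN' H i; have [? ?] := H i; split=> //; apply: within_mono NN' _. Qed.

Lemma reps_nil c N : c <: N -> reps c N [::] [::].
Proof.
move=> cN i; rewrite !nth_nil num_self; do 2!split=> //; exact: sub_refl.
Qed.

Lemma reps_cons c N x X n v : within c N x -> num c x = n -> reps c N X v ->
  reps c N (x :: X) (n :: v).
Proof. by move=> ? ? H [|i] //=. Qed.

Lemma reps_behead c N X v : reps c N X v -> reps c N (behead X) (behead v).
Proof. by move=> H i; rewrite !nth_behead; apply: H. Qed.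

Lemma reps_head c N X v : reps c N X v ->
  within c N (head c X) /\ num c (head c X) = head 0 v.
Proof. by move=> /(_ 0); rewrite !nth0. Qed.

Lemma exists_reps c N (v : seq nat) : chain N -> c <: N ->
  (forall k, k \in v -> k <= num c N) -> exists2 X, size X = size v & reps c N X v.
Proof.
move=> cN sN; elim: v => [|k v IH] le; first by exists [::] => //; apply: reps_nil.
have [|X sX HX] := IH; first by move=> m mv; apply: le; rewrite inE mv orbT.
have [|x xN xk] := @exists_num c N k cN sN; first by apply: le; rewrite inE eqxx.
by exists (x :: X); [rewrite /= sX | apply: reps_cons].
Qed.

(** * Agreement of [rel] with computation *)

Section Correctness.

Variables c q r : term.
Hypotheses (cq : apart c q) (cr : apart c r) (qr : apart q r).

(** A marker under [x] would lie on the chain [N] and be comparable with [c]; a marker above [x]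
    would be above [c]. Incomparability with [c] thus spreads to everything between [c] and [N]. *)
Lemma within_loose N x : chain N -> within c N x -> loose q r x.
Proof.
move=> cN [cx xN]; have cN' := sub_trans cx xN.
have H s : apart c s -> apart s x.
  move=> [cs sc]; split=> [sx|xs]; last by apply: cs; apply: sub_trans cx xs.
  by case: (cN c cN' s (sub_trans sx xN)).
by split; apply: H.
Qed.

(** Entries are added one by one. Only the indices below [m] need a place on the chain, hence the
    bound [(num c N).+1]. *)
Lemma exists_code N (s : nat -> nat) m : chain N -> c <: N -> m <= (num c N).+1 ->
  (forall k, k < m -> s k <= num c N) ->
  exists W, forall i v, within c N i -> within c N v ->
    codes q r W i v <-> num c i < m /\ num c v = s (num c i).
Proof.
move=> cN sN; elim: m => [|m IH] mN sm.
  by exists Bot => i v _ _; split=> [/(codes_Bot qr)|[]].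
have [||W HW] := IH; [exact: ltnW | by move=> k km; apply: sm; apply: ltnW |].
have [x xN xm] := exists_num cN sN mN.
have [w wN ws] := exists_num cN sN (sm m (ltnSn m)).
exists (Node (Node (Node q x) (Node r w)) W) => i v iN vN.
rewrite codes_Node //; try exact: within_loose cN _.
rewrite HW // ltnS; split=> [[[-> ->]|[lt E]]|[le E]].
- by rewrite xm ws.
- by rewrite E ltnW.
- have [im|ne] := eqVneq (num c i) m; last by right; rewrite ltn_neqAle ne le.
  by left; split; [apply: (num_inj cN iN xN) | apply: (num_inj cN vN wN)];
    rewrite ?xm ?ws ?E im.
Qed.

(** By induction on [f], for all chains at once, since subcomputations run on longer ones. From
    right to left, [grow] supplies a chain long enough for all intermediate values. *)
Lemma relP n (f : recfun n) N X y (v : n.-tuple nat) : chain N ->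
  reps c N X v -> within c N y -> rel f c q r N X y <-> computes f v (num c y).
Proof.
elim: n / f N X y v => [n||n i|k n f IHf g IHg|n f IHf g IHg|n f IHf]
  N X y v cN HX Hy.
- have sN : c <: N by case: Hy => cy /(sub_trans cy).
  have Wc : within c N c by split=> //; apply: sub_refl.
  rewrite /=; split=> [->|E]; first exact: num_self.
  by apply: (num_inj cN Hy Wc); rewrite num_self.
- have [H0 V0] := reps_head HX; rewrite /= (coverP cN H0 Hy) V0.
  by case/tupleP: v {HX V0} => a v; rewrite theadE.
- have [Hi Vi] := HX i; rewrite /= (tnth_nth 0) -Vi; split=> [->//|].
  exact: num_inj cN Hy Hi.
- have sN : c <: N by case: Hy => cy /(sub_trans cy).
  split=> [[N' [[NN' cN'] [w [sw [Hg Hf]]]]]|[w Hg Hf]].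
    have sN' := sub_trans sN NN'.
    (* Indices from [k] on yield the default [c], which represents 0, the default on the side of
       numbers. *)
    have Hw : reps c N' w [seq num c z | z <- w].
      move=> i; have [ik|ki] := ltnP i k; last first.
        rewrite !nth_default ?size_map ?sw // num_self; do 2!split=> //.
        exact: sub_refl.
      rewrite (nth_map c) ?sw //; split=> //.
      by case: (Hg (Ordinal ik)).
    have sz : size [seq num c z | z <- w] == k by rewrite size_map sw.
    exists (Tuple sz) => [i|].
      have [Wi /IHg] := Hg i; move=> /(_ v cN' (reps_mono NN' HX) Wi).
      by rewrite (tnth_nth 0) /= (nth_map c) ?sw.
    by apply/(IHf N' w y (Tuple sz)) => //; apply: within_mono NN' _.
  pose K := \max_(z <- w) z.
  have cN' : chain (grow K N) by apply: chain_grow.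
  have NN' := sub_grow K N; have sN' := sub_trans sN NN'.
  have [z zw|W sW HW] := @exists_reps c (grow K N) w cN' sN'.
    have : z <= K by apply: leq_bigmax_seq.
    by move: (sub_le sN); rewrite /num height_grow; lia.
  exists (grow K N); split=> //; exists W; split; first by rewrite sW size_tuple.
  split; last by apply/(IHf _ _ _ w) => //; apply: within_mono NN' _.
  move=> i; have [Wi Vi] := HW i; split=> //.
  apply/(IHg _ _ _ _ v) => //; first exact: reps_mono NN' HX.
  by rewrite Vi -tnth_nth; apply: Hg.
- have sN : c <: N by case: Hy => cy /(sub_trans cy).
  case/tupleP: v HX => n0 v HX.
  have [H0 V0] := reps_head HX; have HX' := reps_behead HX.
  rewrite /= in V0 HX'.
  pose v' := [tuple of behead [tuple of n0 :: v]].
  have Wc N' : N <: N' -> within c N' c.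
    by move=> NN'; split; [apply: sub_refl | apply: sub_trans NN'].
  rewrite [computes _ _ _]/= theadE -/v' -V0; split.
    move=> [N' [[NN' cN'] [W [Wn HW]]]].
    have HX'' : reps c N' (behead X) v' by apply: reps_mono NN' HX'.
    have H0' := within_mono NN' H0; have Hy' := within_mono NN' Hy.
    (* Induction on the index traces one entry of [W] back to its predecessor until [c] is reached.
       The values met form the sequence [s], so [W] need not code a function. *)
    have [m E] : exists m, m = num c (head c X) by exists (num c (head c X)).
    rewrite -E; elim: m (head c X) y H0' Hy' Wn E {H0 V0 HX Hy} => [|m IH] i z Hi Hz Wz E;
      case: (HW i (proj2 Hi) z (proj2 Hz) (conj (conj (proj1 Hi) (proj1 Hz)) Wz)).
    + move=> [_ /(IHf N' _ z v' cN' HX'' Hz) fz]; by exists (fun _ => num c z).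
    + by move=> [j [[Hj /(coverP cN' Hj Hi)]]]; rewrite -E.
    + by move=> [Ei _]; move: E; rewrite Ei num_self.
    + move=> [j [[Hj /(coverP cN' Hj Hi)]]]; rewrite -E => -[Ej].
      move=> [u [Hu [/(IH j u Hj Hu)/(_ Ej) [s [s0 sS Eu]]]]].
      move=> /(IHg N' _ z [tuple of [:: num c j, num c u & v']] cN' _ Hz) gz.
      exists (fun k => if k <= m then s k else num c z); split=> [//|k|]; last by rewrite ltnn.
      rewrite ltnS => km; rewrite km; have [->|ne] := eqVneq k m.
        rewrite ltnn -Eu; apply: computes_eq (gz _); rewrite /= -?Ej //.
        by do 2![apply: reps_cons => //].
      by have lt : k < m; [rewrite ltn_neqAle ne | rewrite lt; apply: computes_eq (sS k lt)].
  move=> [s [s0 sS Ey]].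
  (* The values [s 0] to [s n], with [n] the recursion argument, are at most [K], so they all fit
     after growing by [K]. *)
  pose K := \max_(i < (num c (head c X)).+1) s i.
  have cN' : chain (grow K N) by apply: chain_grow.
  have NN' := sub_grow K N; have sN' := sub_trans sN NN'.
  have HX'' : reps c (grow K N) (behead X) v' by apply: reps_mono NN' HX'.
  have H0' := within_mono NN' H0; have Hy' := within_mono NN' Hy.
  have sK k : k <= num c (head c X) -> s k <= num c (grow K N).
    rewrite -ltnS => kn; have : s k <= K by apply: (leq_bigmax (Ordinal kn)).
    by move: (sub_le sN); rewrite /num height_grow; lia.
  have [||W HW] := @exists_code _ s (num c (head c X)).+1 cN' sN'.
  - by rewrite ltnS; apply: num_le.
  - by move=> k; rewrite ltnS; apply: sK.
  exists (grow K N); split=> //; exists W; split; first by apply/HW.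
  move=> i iN z zN [[ci cz]].
  have Hi : within c (grow K N) i by [].
  have Hz : within c (grow K N) z by [].
  move=> /(HW _ _ Hi Hz) [+ Ez].
  case E: (num c i) => [|m] lm.
    left; split; first by apply: (num_inj cN' Hi (Wc _ NN')); rewrite num_self.
    by apply/(IHf _ _ _ v') => //; rewrite Ez E.
  right; have [|j Hj Ej] := @exists_num c (grow K N) m cN' sN'.
    by apply: leq_trans (num_le Hi); rewrite E.
  have [|u Hu Eu] := @exists_num c (grow K N) (s m) cN' sN'; first by apply: sK; lia.
  exists j; split; first by split=> //; apply/(coverP cN' Hj Hi); rewrite E Ej.
  exists u; split=> //; split; first by apply/HW => //; rewrite Ej Eu; split=> //; lia.
  apply/(IHg _ _ _ [tuple of [:: m, s m & v']]) => //.
    by do 2![apply: reps_cons => //].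
  by rewrite Ez E; apply: computes_eq (sS m lm).
- have sN : c <: N by case: Hy => cy /(sub_trans cy).
  have Wc N' : N <: N' -> within c N' c.
    by move=> NN'; split; [apply: sub_refl | apply: sub_trans NN'].
  rewrite /= (IHf N _ c [tuple of num c y :: v] cN (reps_cons Hy erefl HX) (Wc N (sub_refl N))).
  rewrite num_self; split=> -[f0 H]; split=> // i.
    move=> iy; have [|x Hx Ex] := @exists_num c N i cN sN.
      by apply: leq_trans (num_le Hy); apply: ltnW.
    have /(num_lt cN Hx Hy)[xy nxy] : num c x < num c y by rewrite Ex.
    have [N' [[NN' cN'] [k [[Hk kc]]]]] := H x xy (conj (proj1 Hx) nxy).
    have HX' := reps_cons (within_mono NN' Hx) Ex (reps_mono NN' HX).
    move=> /(IHf N' _ k [tuple of i :: v] cN' HX' Hk) fk.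
    case E: (num c k) fk => [|m] fk; last by exists m.
    by case: kc; apply: (num_inj cN' Hk (Wc _ NN')); rewrite E num_self.
  move=> iy [ci niy]; have Hi : within c N i by split=> //; apply: sub_trans iy (proj2 Hy).
  have [k fk] := H _ (proj2 (num_lt cN Hi Hy) (conj iy niy)).
  (* The value of [f] at [i] is [k.+1]; its representative must fit on the chain, and being nonzero
     it differs from [c]. *)
  have cN' : chain (grow k.+1 N) by apply: chain_grow.
  have NN' := sub_grow k.+1 N; have sN' := sub_trans sN NN'.
  have [|z Hz Ez] := @exists_num c (grow k.+1 N) k.+1 cN' sN'.
    by move: (sub_le sN); rewrite /num height_grow; lia.
  exists (grow k.+1 N); split=> //; exists z; split.
    by split=> // zc; move: Ez; rewrite zc num_self.
  apply/(IHf _ _ _ [tuple of num c i :: v]); rewrite ?Ez //.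
  by apply: reps_cons => //; [apply: within_mono NN' Hi | apply: reps_mono NN' HX].
Qed.

End Correctness.

(** * Recursive functions *)

Definition recfn n (F : n.-tuple nat -> nat) : Prop :=
  exists f : recfun n, forall v, computes f v (F v).

Definition rec1 (F : nat -> nat) : Prop :=
  recfn (fun v : 1.-tuple nat => F (nth 0 v 0)).

Definition rec2 (F : nat -> nat -> nat) : Prop :=
  recfn (fun v : 2.-tuple nat => F (nth 0 v 0) (nth 0 v 1)).

Lemma recfn_nth n i : i < n -> recfn (fun v : n.-tuple nat => nth 0 v i).
Proof. by move=> lt; exists (Proj (Ordinal lt)) => v; rewrite /= (tnth_nth 0). Qed.

Lemma rec1_app n F (G : n.-tuple nat -> nat) :
  rec1 F -> recfn G -> recfn (fun v => F (G v)).
Proof.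
move=> [f Hf] [g Hg]; exists (Comp f (fun _ => g)) => v.
exists [tuple G v]; last exact: Hf [tuple G v].
by move=> i; rewrite (tnth_nth 0) ord1; apply: Hg.
Qed.

Lemma rec2_app n F (G H : n.-tuple nat -> nat) :
  rec2 F -> recfn G -> recfn H -> recfn (fun v => F (G v) (H v)).
Proof.
move=> [f Hf] [g Hg] [h Hh].
exists (Comp f (fun i => if val i == 0 then g else h)) => v.
exists [tuple G v; H v]; last exact: Hf [tuple G v; H v].
by case=> [[|[|i]] lt] //; rewrite (tnth_nth 0) /=.
Qed.

Lemma recfn_const n m : recfn (fun _ : n.-tuple nat => m).
Proof.
elim: m => [|m IH]; first by exists (Zero n).
by apply: (rec1_app (F := S)) IH; exists Succ => v; rewrite /= /thead (tnth_nth 0).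
Qed.

(** The function [H] itself provides the course of values demanded by [PrimRec]. *)
Lemma recfn_rec n F (G : n.+2.-tuple nat -> nat) H : recfn F -> recfn G ->
  (forall v : n.-tuple nat, H [tuple of 0 :: v] = F v) ->
  (forall i (v : n.-tuple nat), H [tuple of i.+1 :: v] =
     G [tuple of [:: i, H [tuple of i :: v] & v]]) -> recfn H.
Proof.
move=> [f Hf] [g Hg] H0 HS; exists (PrimRec f g); case/tupleP=> a v.
exists (fun i => H [tuple of i :: v]); split=> [|i _|].
- by rewrite H0; apply: computes_eq (Hf v).
- by rewrite HS; apply: computes_eq (Hg _).
- by rewrite theadE.
Qed.

Lemma rec1_rec a G H : rec2 G -> H 0 = a -> (forall i, H i.+1 = G i (H i)) -> rec1 H.
Proof.
move=> RG H0 HS; apply: (recfn_rec (recfn_const 0 a) RG) => [v|i v] /=; first exact: H0.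
exact: HS.
Qed.

Lemma rec2_rec F G H : rec1 F -> rec2 G -> (forall y, H 0 y = F y) ->
  (forall i y, H i.+1 y = G (H i y) y) -> rec2 H.
Proof.
move=> RF RG H0 HS; apply: (recfn_rec RF (rec2_app RG (@recfn_nth 3 1 isT) (@recfn_nth 3 2 isT))).
  by move=> v; rewrite /= H0.
by move=> i v; rewrite /= HS.
Qed.

Lemma rec1_succ : rec1 S.
Proof. by exists Succ => v; rewrite /= /thead (tnth_nth 0). Qed.

Lemma rec2_add : rec2 addn.
Proof.
by apply: (rec2_rec (F := id) (G := fun a _ => a.+1));
  [exact: recfn_nth | apply: rec1_app rec1_succ _; exact: recfn_nth | |].
Qed.

Lemma rec2_cpair : rec2 cpair.
Proof.
(* Triangular numbers are obtained by summation, which avoids multiplication and halving. *)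
have tri : rec1 (fun s => (s * s.+1)./2).
  apply: (@rec1_rec 0 (fun i a => a + i.+1)) => // [|i].
    apply: rec2_app rec2_add _ _; first exact: recfn_nth.
    by apply: rec1_app rec1_succ _; exact: recfn_nth.
  lia.
apply: (rec2_app rec2_add); last exact: recfn_nth.
by apply: (rec1_app tri); apply: rec2_app rec2_add _ _; exact: recfn_nth.
Qed.

Lemma recfn_cpair_const n a (G : n.-tuple nat -> nat) :
  recfn G -> recfn (fun v => cpair a (G v)).
Proof. exact: rec2_app rec2_cpair (recfn_const n a). Qed.

(** * Diagonalization *)

(** The relation [cover] between variables 2 and 0, written out because numerals need a formula with
    a known code, while [Sdef] only asserts existence. *)
Definition cover_formula : formula :=
  FAnd (FSub 2 0) (FAnd (FNeg (FEq 2 0)) (FBAll 3 0 (FOr (FEq 3 0) (FSub 3 2)))).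

(* Says that x0 lies n steps above x1; the variables 0 and 2 are reused so that
   the code of numeral n is primitive recursive in n. *)
Fixpoint numeral (n : nat) : formula :=
  if n is m.+1 then
    FEx 2 (FAnd cover_formula (FEx 0 (FAnd (FEq 0 2) (numeral m))))
  else FEq 0 1.

(** Quantification over a base point and the element [n] steps above it replaces substitution of a
    numeral into [p]. *)
Definition instance (n : nat) (p : formula) : formula :=
  FEx 1 (FEx 0 (FAnd (numeral n) p)).

(** This is the code of [instance n p] when [n] is the code of [p]. *)
Definition diagonal (n : nat) : nat :=
  cpair 6 (cpair 1 (cpair 6 (cpair 0 (cpair 3 (cpair (godel (numeral n)) n))))).

Lemma rec1_diagonal : rec1 diagonal.
Proof.
have num : rec1 (fun n => godel (numeral n)).
  (* Each numeral wraps the previous one in a fixed context, so its code arises by eight pairings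
     with constants. *)
  apply: (@rec1_rec (godel (numeral 0)) (fun _ a => cpair 6 (cpair 2 (cpair 3
    (cpair (godel cover_formula) (cpair 6 (cpair 0 (cpair 3
      (cpair (godel (FEq 0 2)) a))))))))) => //.
  by do 8!apply: recfn_cpair_const; exact: recfn_nth.
do 5!apply: recfn_cpair_const; apply: (rec2_app rec2_cpair); last exact: recfn_nth.
by apply: (rec1_app num); exact: recfn_nth.
Qed.

(** * Meaning of numerals *)

Fixpoint steps (n : nat) (c x : term) : Prop :=
  if n is m.+1 then exists y, cover y x /\ steps m c y else x = c.

Lemma sat_numeral n e : sat subterm e (numeral n) <-> steps n (e 1) (e 0).
Proof.
elim: n e => [|n IH] e //=.
split=> [[y [Cy [a [E /IH Sy]]]]|[y [Cy Sy]]]; exists y; split=> //.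
  by move: E Sy; rewrite /update /= => ->.
by exists y; split=> //; apply/IH.
Qed.

Lemma steps_height n c x : steps n c x -> c <: x /\ num c x = n.
Proof.
rewrite /num => S; suff : c <: x /\ height x = height c + n by case=> ? ->; rewrite addKn.
elim: n x S => [|n IH] x /=; first by move=> ->; rewrite addn0; split=> //; apply: sub_refl.
move=> [y [Cy /IH[cy E]]]; rewrite (cover_height Cy) E addnS; split=> //.
by apply: sub_trans cy _; case: Cy.
Qed.

Lemma steps_grow n c : steps n c (grow n c).
Proof.
elim: n => //= n IH; exists (grow n c); split=> //.
split; first exact: sub_left.
by split=> [/(congr1 height) /=|z]; [lia | case; tauto].
Qed.

Lemma Sigma_numeral n : Sigma (numeral n).
Proof. by elim: n => [|n IH]; repeat constructor. Qed.

Lemma free_numeral n : all (fun x => x < 2) (free_vars (numeral n)).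
Proof.
elim: n => //= n IH; rewrite all_filter; apply/allP=> x.
by rewrite mem_filter => /andP[_ /(allP IH)] /= ->; rewrite implybT.
Qed.

Lemma sentence_instance n p :
  all (fun x => x < 2) (free_vars p) -> sentence (instance n p).
Proof.
move=> fp; have := free_numeral n; rewrite /sentence /= => fn.
have {fn fp} : all (fun x => x < 2) (free_vars (numeral n) ++ free_vars p).
  by rewrite all_cat fn.
by elim: (_ ++ _) => //= -[|[|x]].
Qed.

(** Distinct terms of equal height are incomparable; these three have height 2, and the subterms of
    the first are [Bot], [L] and itself. *)
Lemma exists_markers :
  exists c, exists q, exists r, [/\ chain c, apart c q, apart c r & apart q r].
Proof.
pose L := Node Bot Bot; exists (Node Bot L), (Node L Bot), (Node L L); split.
- move=> s [->|st] u; first by right.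
  case=> [->|ut]; first by left; right.
  have sL : s <: L by case: st => // -[->|[]]; apply: sub_left.
  have uL : u <: L by case: ut => // -[->|[]]; apply: sub_left.
  have cL : chain L by apply: (@chain_grow 1 Bot) => _ [->|[]] _ [->|[]]; left; left.
  exact: cL.
- by split=> /=; intuition discriminate.
- by split=> /=; intuition discriminate.
- by split=> /=; intuition discriminate.
Qed.

(** Here [x0] is both the argument and the ambient chain, and [x1] both the base point and the
    output 0. The formula guesses the markers; since [relP] holds for every admissible choice, its
    truth does not depend on the guess. *)
Lemma representable (f : recfun 1) :
  exists p, [/\ Sigma p, all (fun x => x < 2) (free_vars p) &
    forall n e, sat subterm e (instance n p) <-> computes f [tuple n] 0].
Proof.
pose R (e : env) := exists q, exists r,
  ((~ e 1 <: q /\ ~ q <: e 1) /\ ((~ e 1 <: r /\ ~ r <: e 1) /\ (~ q <: r /\ ~ r <: q))) /\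
  (chain (e 0) /\ rel f (e 1) q r (e 0) [:: e 0] (e 1)).
have SR : Sdef R.
  do 2!apply: Sdef_ex; apply: Sdef_and.
    by do ?[apply: Sdef_and]; apply: Sdef_nsub; apply: isvar_proj.
  apply: Sdef_and; first by case: (Ddef_chain 2).
  apply: Sdef_rel; last exact: isvar_proj.
  by apply: isvars_cons; [apply: isvar_proj | apply: isvars_nil].
(* Renaming by [minn i 1] keeps indices 0 and 1 and sends all others to 1, so only two variables can
   be free. *)
have [|p [Sp fp H]] := SR 2 (fun i => minn i 1); first by move=> i; rewrite ltnS geq_minr.
have {}H e : sat subterm e p <-> R e by apply: (H e (fun i => e (minn i 1))).
have relE c q r x n : apart c q -> apart c r -> apart q r -> chain x -> steps n c x ->
    rel f c q r x [:: x] c <-> computes f [tuple n] 0.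
  move=> cq cr qr cx /steps_height[cx' xn].
  have cxx : within c x c by split=> //; apply: sub_refl.
  have rx : reps c x [:: x] [tuple n].
    by apply: reps_cons => //; [split=> //; apply: sub_refl | apply: reps_nil].
  by have := relP cq cr qr f cx rx cxx; rewrite num_self.
exists p; split=> // n e; split.
  move=> [c [x [/sat_numeral S /H[q [r [[cq [cr qr]] [cx Rf]]]]]]].
  exact/(relE _ _ _ _ _ cq cr qr cx S).
move=> fn; have [c [q [r [cc cq cr qr]]]] := exists_markers.
exists c, (grow n c); split; first by apply/sat_numeral; apply: steps_grow.
have cx : chain (grow n c) by apply: chain_grow.
apply/H; exists q, r; split; first by split=> //; split.
by split=> //; apply/(relE _ _ _ _ _ cq cr qr cx (steps_grow n c)).
Qed.

Theorem theorem3 : ~ decidable_theory (Sigma_theory subterm).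
Proof.
move=> [f Hf]; have [d Hd] := rec1_diagonal.
have [p [Sp fp Hp]] := representable (Comp f (fun _ => d)).
set n := godel p; set G := instance n p.
have HG : holds subterm G <-> computes f [tuple godel G] 0.
  (* This is where [n] being the code of [p] itself enters. *)
  have -> : godel G = diagonal n by [].
  have dn : computes d [tuple n] (diagonal n) by apply: Hd.
  split=> [/(_ (fun _ => Bot))/Hp[w Hw fw]|fn e].
    have -> : [tuple diagonal n] = w; last by [].
    by apply: eq_from_tnth => i; rewrite (tnth_nth 0) ord1; apply: computes_inj dn (Hw ord0).
  apply/Hp; exists [tuple diagonal n]; last exact: fn.
  move=> i.
  by rewrite ord1 (tnth_nth 0).
have TG : Sigma_theory subterm G <-> holds subterm G.
  split=> [[]//|H]; split=> //; last exact: sentence_instance.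
  by do !constructor=> //; apply: Sigma_numeral.
have [HT HF] := Hf (godel G).
(* If [G] held, [f] would return 1 as a decision procedure and 0 by the meaning of [G]. So [G]
   fails, [f] rejects it, and that is just what [G] asserts. *)
have nT : ~ holds subterm G.
  move=> H; have f1 := HT (ex_intro2 _ _ G (proj2 TG H) erefl).
  by have := computes_inj f1 (proj1 HG H).
apply: (nT); apply/HG; apply: HF => -[p' Tp' /godel_inj E].
by apply: nT; apply/TG; rewrite -E.
Qed.
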